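(* Let $n$ be a positive integer. Every locally $\aleph_n$-bounded topological group is either precompact or ambitable.
   Context: All topological groups are assumed to be Hausdorff. For a topological group $G$, $\mathcal{RP}(G)$ denotes the set of all continuous right-invariant pseudometrics $\Delta$ on $G$ (right-invariant: $\Delta(xz,yz)=\Delta(x,y)$ for all $x,y,z\in G$). The right uniformity on $G$ is the uniformity generated by $\mathcal{RP}(G)$; $G$ with this uniformity is denoted $rG$. $\mathbf{U_b}(rG)$ is the space of all bounded uniformly continuous real-valued functions on $rG$. $G$ is precompact if the uniform space $rG$ is precompact (i.e. totally bounded). For a pseudometric $\Delta$ on $G$, $\mathrm{BLip}^+(\Delta)=\{f:G\to\mathbb{R} \mid 0\le f(x)\le 1 \text{ and } |f(x)-f(y)|\le \Delta(x,y) \text{ for all } x,y\in G\}$. For $f:G\to\mathbb{R}$ and $x\in G$, $\rho^x(f)$ is the function $z\mapsto f(zx)$; $\mathrm{orb}(f)=\{\rho^x(f)\mid x\in G\}$, and $\overline{\mathrm{orb}(f)}$ is its closure in the product space $\mathbb{R}^G$ (pointwise convergence). $G$ is ambitable if for each $\Delta\in\mathcal{RP}(G)$ there exists $f\in\mathbf{U_b}(rG)$ such that $\mathrm{BLip}^+(\Delta)\subseteq\overline{\mathrm{orb}(f)}$. For an infinite cardinal $\kappa$, $G$ is locally $\kappa$-bounded if its identity element has a neighbourhood $U$ such that for each $\Delta\in\mathcal{RP}(G)$ there is a $\Delta$-dense subset $H$ of $U$ (that is, $H\subseteq U$ is dense in $U$ with respect to $\Delta$) with $|H|\le\kappa$.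 Here $\aleph_0$ is the smallest infinite cardinal and $\aleph_{n+1}=\aleph_n^+$. *)

(* Defs.v *)
From HB Require Import structures.
From mathcomp Require Import all_boot all_order all_algebra.
From mathcomp Require Import all_classical all_reals.
From mathcomp Require Import topology normedtype.

Set Implicit Arguments.
Unset Strict Implicit.
Unset Printing Implicit Defensive.

Import Order.TTheory GRing.Theory Num.Theory.
Import numFieldNormedType.Exports.

Local Open Scope classical_set_scope.
Local Open Scope card_scope.
Local Open Scope ring_scope.

(* Cardinals are represented by types and compared through injections (#<=).  *)

Definition card_lt (X Y : Type) : Prop :=
  [set: X] #<= [set: Y] /\ ~ ([set: Y] #<= [set: X]).

Definition is_succ_card (X Y : Type) : Prop :=
  card_lt X Y /\ forall Z : Type, card_lt X Z -> [set: Y] #<= [set: Z].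

Lemma inj_le_card (T U : Type) (A : set T) (B : set U) (f : T -> U) :
  {in A &, injective f} -> f @` A `<=` B -> A #<= B.
Proof.
move=> fI fAB; apply: card_le_trans (subset_card_le fAB).
by have := inj_card_eq fI; rewrite card_eq_le => /andP[].
Qed.

Lemma card_least (T I : Type) (S : I -> set T) (i0 : I) :
  exists i, forall j, S i #<= S j.
Proof.
pose P (F : set (I -> T)) := (forall p i, F p -> S i (p i)) /\
  (forall p q i, F p -> F q -> p i = q i -> p = q).
have [F FP Ftot|F [[FS FI] Fmax]] := @Zorn_bigcup (I -> T) P.
  split=> [p i [X FX Xp]|p q i [X FX Xp] [Y FY Yq]].
    by have [+ _] := FP _ FX; exact.
  have [XY|YX] := Ftot _ _ FX FY.
    by have [_] := FP _ FY; apply => //; exact: XY.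
  by have [_] := FP _ FX; apply => //; exact: YX.
have [i Si] : exists i, S i `<=` [set p i | p in F].
  apply: contrapT => /forallNP nS.
  have {nS} /choice[q qS] : forall i, exists t, S i t /\ ~ [set p i | p in F] t.
    by move=> i; have /existsNP[t /not_implyP[St nt]] := nS i; exists t.
  apply: (Fmax (F `|` [set q])).
    split=> [|/(_ q)]; first exact: subsetUl.
    move=> /(_ (or_intror erefl)) Fq; case: (qS i0) => _; apply.
    by exists q.
  split=> [p i [/FS //|->]|p p' i [Fp|->] [Fp'|->] //]; first by case: (qS i).
  - exact: FI.
  - by move=> pq; case: (qS i) => _; case; exists p.
  - by move=> pq; case: (qS i) => _; case; exists p'.
exists i => j; apply: (card_le_trans (subset_card_le Si)).
apply: (card_le_trans (card_image_le _ _)).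
apply: (@inj_le_card _ _ _ _ (fun p => p j)).
  by move=> p q /set_mem Fp /set_mem Fq; exact: FI.
by move=> _ [p Fp <-]; exact: FS.
Qed.

Lemma card_le_total (T U : Type) (A : set T) (B : set U) :
  A #<= B \/ B #<= A.
Proof.
have lA : @inl T U @` A #= A by apply: inj_card_eq => x y _ _ [].
have rB : @inr T U @` B #= B by apply: inj_card_eq => x y _ _ [].
have [b bP] := card_least (fun b : bool => if b then @inl T U @` A else @inr T U @` B) true.
case: b bP => [/(_ false)|/(_ true)] /=.
  by rewrite (card_le_eql lA) (card_le_eqr rB); left.
by rewrite (card_le_eqr lA) (card_le_eql rB); right.
Qed.

Lemma cantor_card_lt (X : Type) : card_lt X (set X).
Proof.
split.
  apply: (@inj_le_card _ _ _ _ (@set1 X)) => // x y _ _ xy.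
  by have : [set x] x by []; rewrite xy.
move=> /card_leP[f].
have memT (A : set X) : A \in [set: set X] by exact: mem_setT.
pose g (A : set X) : X := \val (f (SigSub (memT A))).
have gI A B : g A = g B -> A = B.
  move=> /val_inj /('inj_f) AB.
  by have /(congr1 val) := AB (mem_setT _) (mem_setT _).
pose D := [set x | exists A, g A = x /\ ~ A x].
have nD : ~ D (g D).
  by move=> DgD; move: (DgD) => [A [/gI AD]]; rewrite AD.
by apply: (nD); exists D; split.
Qed.

Lemma succ_card_exists (X : Type) : exists Y : Type, is_succ_card X Y.
Proof.
pose ltX T (A : set T) := [set: X] #<= A /\ ~ (A #<= [set: X]).
have ltXT : ltX _ [set: set X] := cantor_card_lt X.
pose I := {S : set (set X) | ltX _ S}.
have [[S SX] /= Smin] := card_least (fun S : I => sval S) (exist _ _ ltXT).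
exists (set_type S); split.
  by rewrite /card_lt (card_le_eqr (card_setT S)) (card_le_eql (card_setT S)).
move=> Z [XZ ZX]; rewrite (card_le_eql (card_setT S)).
have [ZP|PZ] := card_le_total [set: Z] [set: set X]; last first.
  exact: card_le_trans (Smin (exist _ _ ltXT)) PZ.
have /pcard_leTP[f] := ZP.
have fZ : f @` [set: Z] #= [set: Z] by apply: inj_card_eq.
have ltXf : ltX _ (f @` [set: Z]).
  by rewrite /ltX (card_le_eqr fZ) (card_le_eql fZ).
by have := Smin (exist _ _ ltXf); rewrite /= (card_le_eqr fZ).
Qed.

Definition succ_card (X : Type) : Type := projT1 (cid (succ_card_exists X)).

Lemma succ_cardP (X : Type) : is_succ_card X (succ_card X).
Proof. exact: (projT2 (cid (succ_card_exists X))). Qed.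

Fixpoint aleph (n : nat) : Type :=
  if n is m.+1 then succ_card (aleph m) else nat.

HB.mixin Record isTopologicalGroup G & Group G & Topological G := {
  mulg_continuous : continuous (fun xy : G * G => (xy.1 * xy.2)%g);
  invg_continuous : continuous (fun x : G => (x^-1)%g)
}.

#[short(type="topologicalGroupType")]
HB.structure Definition TopologicalGroup :=
  {G of Group G & Topological G & isTopologicalGroup G}.

Definition is_pseudometric (R : realType) (T : Type) (D : T -> T -> R) : Prop :=
  [/\ forall x, D x x = 0,
      forall x y, 0 <= D x y,
      forall x y, D x y = D y x &
      forall x y z, D x z <= D x y + D y z].

(* RP R G is the set of continuous right-invariant pseudometrics on G. *)
Definition RP (R : realType) (G : topologicalGroupType) : set (G -> G -> R) :=
  [set D | [/\ is_pseudometric D,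
               continuous (fun xy : G * G => D xy.1 xy.2) &
               forall x y z : G, D (x * z)%g (y * z)%g = D x y]].

Arguments RP : clear implicits.

(* The uniformity generated by RP R G: finite intersections of the sets       *)
(* {(x, y) | D x y < e} form a base.                                          *)
Definition right_entourage (R : realType) (G : topologicalGroupType) :
    set_system (G * G) :=
  [set E | exists (A : set (G -> G -> R)) (e : R),
     [/\ finite_set A, A `<=` RP R G, 0 < e &
         forall x y, (forall D, A D -> D x y < e) -> E (x, y)]].

Arguments right_entourage : clear implicits.

(* G with its right uniformity; its topology is the one induced by the        *)
(* uniformity, independently of the topology carried by G.                    *)
Definition rG (R : realType) (G : topologicalGroupType) : Type := G.

HB.instance Definition _ (R : realType) (G : topologicalGroupType) :=
  Choice.copy (rG R G) G.

Lemma right_entourage_filter (R : realType) (G : topologicalGroupType) :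
  Filter (right_entourage R G).
Proof.
split.
- by exists set0, 1; split => //; exact: finite_set0.
- move=> P Q [A [e [fA AR e0 AP]]] [B [d [fB BR d0 BQ]]].
  exists (A `|` B), (Num.min e d); split.
  + by rewrite finite_setU.
  + by rewrite subUset.
  + by rewrite lt_min e0.
  + move=> x y AB; split; [apply: AP|apply: BQ] => D DA.
      by have := AB _ (or_introl DA); rewrite lt_min => /andP[].
    by have := AB _ (or_intror DA); rewrite lt_min => /andP[].
- by move=> P Q PQ [A [e [? ? ? AP]]]; exists A, e; split=> // x y /AP /PQ.
Qed.

Lemma right_entourage_refl (R : realType) (G : topologicalGroupType)
    (E : set (G * G)) : right_entourage R G E -> diagonal `<=` E.
Proof.
move=> [A [e [_ AR e0 AE]]] [x y]; rewrite /diagonal /= => <-; apply: AE => D /AR[[D0 _ _ _] _ _].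
by rewrite D0.
Qed.

Lemma right_entourage_inv (R : realType) (G : topologicalGroupType)
    (E : set (G * G)) : right_entourage R G E -> right_entourage R G E^-1%relation.
Proof.
move=> [A [e [fA AR e0 AE]]]; exists A, e; split=> // x y xy; apply: AE => D DA.
by have [[_ _ Dsym _] _ _] := AR _ DA; rewrite Dsym; exact: xy.
Qed.

Lemma right_entourage_split (R : realType) (G : topologicalGroupType)
    (E : set (G * G)) : right_entourage R G E ->
  exists2 B, right_entourage R G B & (B \; B `<=` E)%relation.
Proof.
move=> [A [e [fA AR e0 AE]]].
exists [set xy | forall D, A D -> D xy.1 xy.2 < e / 2].
  by exists A, (e / 2); split=> //; rewrite divr_gt0.
move=> [x z] [y /= xy yz]; apply: AE => D DA.
have [[_ _ _ Dtri] _ _] := AR _ DA; apply: le_lt_trans (Dtri x y z) _.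
by rewrite [ltRHS]splitr ltrD ?xy ?yz.
Qed.

HB.instance Definition _ (R : realType) (G : topologicalGroupType) :=
  @isUniform.Build (rG R G) (right_entourage R G)
    (right_entourage_filter R G) (@right_entourage_refl R G)
    (@right_entourage_inv R G) (@right_entourage_split R G).

(* The library's precompact means relatively compact, hence this definition. *)
Definition totally_bounded (U : uniformType) : Prop :=
  forall E : set (U * U), entourage E ->
    exists2 F : set U, finite_set F & forall x, exists2 y, F y & E (y, x).

Definition precompact_group (R : realType) (G : topologicalGroupType) : Prop :=
  totally_bounded (rG R G).

Definition Ub (R : realType) (U : uniformType) : set (U -> R) :=
  [set f | bounded_fun f /\ unif_continuous f].

Arguments Ub : clear implicits.

Definition BLip_plus (R : realType) (T : Type) (D : T -> T -> R) :
    set (T -> R) :=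
  [set f | (forall x, 0 <= f x <= 1) /\
           (forall x y, `|f x - f y| <= D x y)].

Definition rho (R : realType) (G : topologicalGroupType) (x : G) (f : G -> R) :
    G -> R :=
  fun z => f (z * x)%g.

Definition orb (R : realType) (G : topologicalGroupType) (f : G -> R) :
    set (G -> R) :=
  [set rho x f | x in [set: G]].

Definition ambitable (R : realType) (G : topologicalGroupType) : Prop :=
  forall D, RP R G D ->
    exists2 f : G -> R, Ub R (rG R G) f &
      BLip_plus D `<=` closure (orb f : set {ptws G -> R}).

(* K is a type whose cardinality is the cardinal kappa. *)
Definition locally_bounded (R : realType) (K : Type)
    (G : topologicalGroupType) : Prop :=
  exists2 U : set G, nbhs (1%g : G) U &
    forall D, RP R G D -> exists H : set G,
      [/\ H `<=` U,
          forall x, U x -> forall e : R, 0 < e -> exists2 h, H h & D x h < e &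
          H #<= [set: K]].

(* Main.v *)
Require Import Defs.
From mathcomp Require Import all_boot all_order all_algebra.
From mathcomp Require Import all_classical all_reals.
From mathcomp Require Import topology normedtype.
From mathcomp Require Import lra.
From mathcomp Require wochoice interval_inference.

(** Fix a continuous right-invariant pseudometric Delta on a group that is not
    precompact. A function f whose orbit closure contains BLip+(Delta) can be
    built by hand as soon as finite subsets of G can be translated far apart.
    Let D be a Delta-dense set. A finite list s of pairs (d, q), with d in D
    and q rational, is a finite approximation of the graph of a function.
    There are only |D| such lists when D is infinite. If each s gets a
    translation x_s such that d x_s and d' x_s' are at distance at least 1
    whenever s and s' differ, then

      f y = sup ({0} u {q - Delta (y, d x_s) | (d, q) in s, q <= 1})

    is 1-Lipschitz with values in [0, 1], and around x_s it copies the
    approximation s, because every other piece contributes at most 0 there.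
    So each g in BLip+(Delta) is a pointwise limit of translates of f
    (ambit_dense).

    The x_s are chosen by transfinite recursion along a well-order all of whose
    proper initial segments are smaller than D. Some s gets stuck only when
    G = K B P, with K finite, B the open unit ball at 1, and P smaller than D.
    An argument of B. H. Neumann on coverings by finitely many kinds of
    translates removes K: then G = B^-1 B P' with P' again smaller than D, so
    P' is 2-dense, that is, each point is at distance less than 2 from P' (small_translates_cover, separated_translates).

    It remains to replace Delta by a larger pseudometric for which no 2-dense
    set is smaller than the least dense set D. First enlarge Delta so that its
    unit ball lies in the neighbourhood U of the local boundedness hypothesis,
    which is possible by the Birkhoff-Kakutani theorem (RP_unit_ball_sub), and
    so that no finite set is 1-dense, which is possible since G is not
    precompact. There are two cases.
    - D is not bounded by aleph_n. If P is 1-dense and H is a dense subset of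
      U with at most aleph_n elements, then H P is dense, so |D| <= |H| |P|
      and hence |D| <= |P| (locally_small_net).
    - |D| = aleph_m with m <= n. For each k let P_k be a least 1/(k+1)-dense
      set. Their union is dense, so |D| is at most the cardinality of this
      union, and each P_k is infinite. If m = 0 then |D| <= |P_k| at once;
      otherwise aleph_m is a successor cardinal, hence regular and
      uncountable, and |D| <= |P_k| for some k (aleph_net). This is the place
      where the finiteness of the index n matters: aleph_omega is a countable
      supremum of smaller cardinals.
    Multiplying the pseudometric by a constant turns the radius so obtained
    into 2. *)

Set Implicit Arguments.
Unset Strict Implicit.
Unset Printing Implicit Defensive.

Import Order.TTheory GRing.Theory Num.Theory.
Import numFieldNormedType.Exports.

Local Open Scope classical_set_scope.
Local Open Scope card_scope.
Local Open Scope ring_scope.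

(** * Squares of infinite sets *)

Lemma card_le_funP (T U : Type) (A : set T) (B : set U) (u0 : U) :
  A #<= B -> exists f : T -> U, {in A &, injective f} /\ f @` A `<=` B.
Proof.
move=> /card_leP[f].
have key (x : T) : exists y : U, forall h : x \in A, y = \val (f (SigSub h)).
  have [xA|xA] := pselect (x \in A); last by exists u0.
  exists (\val (f (SigSub xA))) => h.
  by rewrite (bool_irrelevance h xA).
have [g gP] := choice key.
exists g; split.
  move=> x y xA yA; rewrite (gP x xA) (gP y yA) => /val_inj fxy.
  have := 'inj_f (mem_setT _) (mem_setT _) fxy.
  by move=> /(congr1 val).
by move=> _ [x /mem_set xA <-]; rewrite (gP x xA); exact/set_mem/valP.
Qed.

Lemma card_le_inj (T U : Type) (f : T -> U) : injective f ->
  [set: T] #<= [set: U].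
Proof. by move=> fI; apply: (inj_le_card (f := f)) => // x y _ _ /fI. Qed.

Lemma card_leTP (T U : Type) (u0 : U) : [set: T] #<= [set: U] ->
  exists f : T -> U, injective f.
Proof.
move=> /(card_le_funP u0)[f [fI _]]; exists f => x y.
by apply: fI; rewrite in_setT.
Qed.

Section square.
Variable T : Type.

(** A partial operation on T is a set of triples (a, b, f a b), so that the
    upper bound of a chain is the plain union; its carrier is read off the
    diagonal. *)
Let field (F : set (T * T * T)) : set T := [set a | exists c, F (a, a, c)].

Let partial_square (F : set (T * T * T)) : Prop :=
  [/\ forall a b c, F (a, b, c) -> [/\ field F a, field F b & field F c],
      forall a b, field F a -> field F b -> exists c, F (a, b, c),
      forall a b a' b' c, F (a, b, c) -> F (a', b', c) -> a = a' /\ b = b' &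
      forall a b c c', F (a, b, c) -> F (a, b, c') -> c = c'].

Let partial_square_bigcup (F0 : set (T * T * T)) (C : set (set (T * T * T))) :
  partial_square F0 -> (forall G, C G -> partial_square (F0 `|` G)) ->
  total_on C subset -> partial_square (F0 `|` \bigcup_(G in C) G).
Proof.
move=> sF0 sC totC; set F := F0 `|` _.
have dir s t : F s -> F t -> exists G, [/\ partial_square (F0 `|` G),
    F0 `|` G `<=` F, (F0 `|` G) s & (F0 `|` G) t].
  have sub G : C G -> F0 `|` G `<=` F.
    by move=> CG; apply: setUS; exact: bigcup_sup.
  have F0sub : F0 `<=` F by exact: subsetUl.
  move=> [F0s|[G CG Gs]] [F0t|[H CH Ht]].
  - by exists set0; rewrite setU0.
  - by exists H; split; [exact: sC|exact: sub|left|right].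
  - by exists G; split; [exact: sC|exact: sub|right|left].
  - have [GH|HG] := totC _ _ CG CH.
      by exists H; split; [exact: sC|exact: sub|right; exact: GH|right].
    by exists G; split; [exact: sC|exact: sub|right|right; exact: HG].
split.
- move=> a b c Fabc; have [G [[+ _ _ _] GF Gs _]] := dir _ _ Fabc Fabc.
  move=> /(_ _ _ _ Gs)[[x ?] [y ?] [z ?]].
  by split; [exists x|exists y|exists z]; exact: GF.
- move=> a b [x Fa] [y Fb]; have [G [[_ + _ _] GF Ga Gb]] := dir _ _ Fa Fb.
  by move=> /(_ a b)[||c Gc]; [exists x|exists y|exists c; exact: GF].
- move=> a b a' b' c Fs Ft; have [G [[_ _ I _] _ Gs Gt]] := dir _ _ Fs Ft.
  exact: I Gs Gt.
- move=> a b c c' Fs Ft; have [G [[_ _ _ I] _ Gs Gt]] := dir _ _ Fs Ft.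
  exact: I Gs Gt.
Qed.

(** A countable copy of nat in T carries such an operation, coming from a
    pairing function on nat. *)
Let partial_square_nat (e : nat -> T) : injective e ->
  partial_square [set t | exists i j, t = (e i, e j, e (pickle (i, j)))].
Proof.
move=> eI; set F := (X in partial_square X).
have fF i : field F (e i) by exists (e (pickle (i, i))); exists i, i.
split.
- by move=> a b c [i [j [-> -> ->]]].
- by move=> a b [_ [i [_ [-> _ _]]]] [_ [j [_ [-> _ _]]]];
    exists (e (pickle (i, j))); exists i, j.
- move=> a b a' b' c [i [j [-> -> ->]]] [i' [j' [-> ->]]].
  by move=> /eI/(pcan_inj pickleK)[-> ->].
- by move=> a b c c' [i [j [-> -> ->]]] [i' [j' [/eI-> /eI-> ->]]].
Qed.

(** Zorn's lemma gives a maximal A with an injection f : A * A -> A. If the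
    complement of A injects into A, then so does T, with two tags c true and
    c false in A to separate the two parts, and f finishes the proof.
    Otherwise there is an injection j from A to its complement, and f extends
    to the square of A u j A: the pairs outside A * A can be coded in A by
    iterating f, and then sent to j A; this contradicts maximality. *)
Lemma card_square_le : infinite_set [set: T] -> [set: T * T] #<= [set: T].
Proof.
move=> Tinf; have [t0 _] := infinite_setN0 Tinf.
have [e eI] := card_leTP t0 (proj1 (infiniteP _) Tinf).
pose F0 := [set t | exists i j, t = (e i, e j, e (pickle (i, j)))].
have sF0 := partial_square_nat eI.
(* Zorn's lemma is applied to the part added to F0, because the empty chain
   must have an upper bound that contains two distinct tags. *)
have [|G [sG Gmax]] := @Zorn_bigcup _ (fun G => partial_square (F0 `|` G)).
  by move=> C CP totC; apply: partial_square_bigcup.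
pose F := F0 `|` G; pose A := field F.
have [sF1 sF2 sF3 sF4] := sG.
have [f fF] : exists f : T -> T -> T, forall a b, A a -> A b -> F (a, b, f a b).
  have /choice[f fP] : forall p : T * T, exists c, A p.1 -> A p.2 -> F (p, c).
    move=> [a b] /=; have [Aa|] := pselect (A a); last by exists t0.
    have [Ab|] := pselect (A b); last by exists t0.
    by have [c] := sF2 _ _ Aa Ab; exists c.
  by exists (fun a b => f (a, b)) => a b; exact: (fP (a, b)).
have fA a b : A a -> A b -> A (f a b).
  by move=> Aa Ab; have [] := sF1 _ _ _ (fF _ _ Aa Ab).
have fI a b a' b' : A a -> A b -> A a' -> A b' -> f a b = f a' b' ->
    a = a' /\ b = b'.
  move=> Aa Ab Aa' Ab' E; apply: (sF3 _ _ _ _ (f a b)); first exact: fF.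
  by rewrite E; exact: fF.
pose c (s : bool) := e s.
have Ac s : A (c s).
  by exists (e (pickle (nat_of_bool s, nat_of_bool s))); left; exists s, s.
have cI : injective c by move=> [] [] // /eI.
have fA4 a b r s : A a -> A b -> A (f (f a b) (f (c r) (c s))).
  by move=> Aa Ab; apply: (fA); apply: fA.
have [AC|CA] := card_le_total A (~` A); last first.
  have [k [kI kA]] := card_le_funP t0 CA.
  have /choice[h hP] : forall x, exists y, [/\ A y, A x -> y = f x (c true)
      & ~ A x -> y = f (k x) (c false)].
    move=> x; have [Ax|nAx] := pselect (A x).
      by exists (f x (c true)); split=> //; apply: fA.
    exists (f (k x) (c false)); split=> //; apply: fA => //.
    by apply: kA; exists x.
  have hI : injective h.
    move=> x y; have [Ax hx nhx] := hP x; have [Ay hy nhy] := hP y.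
    have kA' z : ~ A z -> A (k z) by move=> ?; apply: kA; exists z.
    have [xA|xA] := pselect (A x); have [yA|yA] := pselect (A y).
    - by rewrite hx // hy // => /fI[].
    - by rewrite hx // nhy // => /fI[]//; [exact: kA'|move=> _ /cI].
    - by rewrite nhx // hy // => /fI[]//; [exact: kA'|move=> _ /cI].
    - rewrite nhx // nhy // => /fI[]//; [exact: kA'|exact: kA'|].
      by move=> /kI E _; apply: E; exact: mem_set.
  apply: (@card_le_inj _ _ (fun p => f (h p.1) (h p.2))) => -[x y] [x' y'] /=.
  have hA z : A (h z) by have [] := hP z.
  by move=> /fI[]// /hI-> /hI->.
have [j [jI jA]] := card_le_funP t0 AC.
have jN a : A a -> ~ A (j a) by move=> Aa; apply: jA; exists a.
(* The points of A u j A are the emb r a with a in A; the pairs in H, where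
   r || s, are those outside A * A. *)
pose emb (s : bool) (a : T) := if s then j a else a.
have embI s t a b : A a -> A b -> emb s a = emb t b -> s = t /\ a = b.
  move=> Aa Ab; case: s; case: t => //=; first by move=> /jI->//; apply: mem_set.
    by move=> E; have := jN _ Aa; rewrite E.
  by move=> E; have := jN _ Ab; rewrite -E.
pose H := [set t | exists a b r s, [/\ A a, A b, r || s &
  t = (emb r a, emb s b, j (f (f a b) (f (c r) (c s))))]].
have fH r a : A a -> field (F `|` H) (emb r a).
  case: r => Aa.
    by exists (j (f (f a a) (f (c true) (c true)))); right; exists a, a, true, true.
  by have [x Fx] := Aa; exists x; left.
have fHP x : field (F `|` H) x -> exists r a, A a /\ x = emb r a.
  move=> [y [Fx|[a [b [r [s [Aa Ab rs [-> _ _]]]]]]]]; last by exists r, a.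
  by exists false, x; split => //; exists y.
have FNH x y z z' : F (x, y, z) -> H (x, y, z') -> False.
  move=> /sF1[Ax Ay _] [a [b [r [s [Aa Ab rs [Ex Ey _]]]]]].
  have [Er _] := embI r false _ _ Aa Ax (esym Ex).
  have [Es _] := embI s false _ _ Ab Ay (esym Ey).
  by move: rs; rewrite Er Es.
have FNHz x y x' y' z : F (x, y, z) -> H (x', y', z) -> False.
  move=> /sF1[_ _ Az] [a [b [r [s [Aa Ab rs [_ _ Ez]]]]]].
  by move: Az; rewrite Ez; apply: jN; exact: fA4.
exfalso; apply: (Gmax (G `|` H)); last first.
  rewrite setUA; change (partial_square (F `|` H)); split.
  - move=> x y z [/sF1[Ax Ay Az]|[a [b [r [s [Aa Ab rs [-> -> ->]]]]]]].
      by split; [exact: (fH false x)|exact: (fH false y)|exact: (fH false z)].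
    by split; [exact: fH|exact: fH|apply: (fH true); exact: fA4].
  - move=> x y /fHP[r [a [Aa ->]]] /fHP[s [b [Ab ->]]].
    have [rs|] := boolP (r || s).
      by exists (j (f (f a b) (f (c r) (c s)))); right; exists a, b, r, s.
    rewrite negb_or => /andP[/negbTE-> /negbTE->].
    by have [z Fz] := sF2 _ _ Aa Ab; exists z; left.
  - move=> x y x' y' z [Fz|Hz] [Fz'|Hz'].
    + exact: (sF3 _ _ _ _ _ Fz Fz').
    + by case: (FNHz _ _ _ _ _ Fz Hz').
    + by case: (FNHz _ _ _ _ _ Fz' Hz).
    + move: Hz Hz' => [a [b [r [s [Aa Ab rs [-> -> ->]]]]]].
      move=> [a' [b' [r' [s' [Aa' Ab' rs' [-> ->]]]]]].
      move=> /jI; rewrite !inE => E.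
      have /fI[] := E (fA _ _ (fA _ _ Aa Ab) (fA _ _ (Ac r) (Ac s)))
        (fA _ _ (fA _ _ Aa' Ab') (fA _ _ (Ac r') (Ac s'))) => //.
      * exact: fA.
      * exact: fA.
      * exact: fA.
      * exact: fA.
      * by move=> /fI[]// -> -> /fI[]// /cI-> /cI->.
  - move=> x y z z' [Fz|Hz] [Fz'|Hz'].
    + exact: (sF4 _ _ _ _ Fz Fz').
    + by case: (FNH _ _ _ _ Fz Hz').
    + by case: (FNH _ _ _ _ Fz' Hz).
    + move: Hz Hz' => [a [b [r [s [Aa Ab rs [-> -> ->]]]]]].
      move=> [a' [b' [r' [s' [Aa' Ab' rs' [E E' ->]]]]]].
      have [-> ->] := embI _ _ _ _ Aa Aa' E.
      by have [-> ->] := embI _ _ _ _ Ab Ab' E'.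
split; first exact: subsetUl.
move=> HG; pose a0 := c true; pose z0 := j (f (f a0 a0) (f a0 a0)).
have Gx : G (j a0, j a0, z0).
  by apply: HG; right; exists a0, a0, true, true; split=> //; exact: Ac.
by apply: (jN a0 (Ac true)); exists z0; right.
Qed.

End square.

Lemma card_le_setX (T T' U U' : Type) (A : set T) (A' : set T') (B : set U)
    (B' : set U') : A #<= A' -> B #<= B' -> A `*` B #<= A' `*` B'.
Proof.
move=> AA BB; have [AB0|/set0P[[a b] [/= Aa Bb]]] := eqVneq (A `*` B) set0.
  by rewrite AB0; exact: card_ge0.
have [a' _] : A' !=set0.
  have [A0|/set0P//] := eqVneq A' set0; move: AA; rewrite A0.
  by move=> /card_le0P E; rewrite E in Aa.
have [b' _] : B' !=set0.
  have [B0|/set0P//] := eqVneq B' set0; move: BB; rewrite B0.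
  by move=> /card_le0P E; rewrite E in Bb.
have [f [fI fA]] := card_le_funP a' AA; have [g [gI gB]] := card_le_funP b' BB.
apply: (inj_le_card (f := fun p => (f p.1, g p.2))).
  move=> [x y] [x' y']; rewrite !inE /= => -[Ax By] [Ax' By'] [/fI-> //]; last 2 first.
  - exact: mem_set.
  - exact: mem_set.
  by move=> /gI->//; exact: mem_set.
by move=> _ [[x y] [/= Ax By] <-]; split; [apply: fA; exists x|apply: gB; exists y].
Qed.

Lemma infinite_card_le (T U : Type) (A : set T) (B : set U) :
  A #<= B -> infinite_set A -> infinite_set B.
Proof. by move=> AB Ainf Bfin; apply: Ainf; exact: card_le_finite AB Bfin. Qed.

Lemma card_setX_self_le (T : Type) (A : set T) :
  infinite_set A -> A `*` A #<= A.
Proof.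
move=> Ainf; have AT : A #<= [set: A].
  by have := card_setT A; rewrite card_eq_le => /andP[].
have TA : [set: A] #<= A by have := card_setT A; rewrite card_eq_le => /andP[].
apply: card_le_trans (card_le_setX AT AT) _; rewrite setXTT.
apply: card_le_trans TA; apply: card_square_le.
exact: infinite_card_le Ainf.
Qed.

(** * Sets smaller than a given infinite set *)

(** When D is infinite, the sets smaller than D form an ideal closed under
    products. This is all the cardinal arithmetic that the construction of
    the translates uses, and it holds for D countable as well. *)
Definition small (T U : Type) (D : set T) (S : set U) : Prop := ~ (D #<= S).

Section small.
Variables (T : Type) (D : set T).
Hypothesis Dinf : infinite_set D.

Lemma small_le (U V : Type) (S : set U) (S' : set V) :
  S #<= S' -> small D S' -> small D S.
Proof. by move=> SS' S'D DS; apply: S'D; exact: card_le_trans SS'. Qed.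

Lemma small_finite (U : Type) (S : set U) : finite_set S -> small D S.
Proof. by move=> Sfin DS; apply: Dinf; exact: card_le_finite Sfin. Qed.

Lemma small_setX (U V : Type) (S : set U) (S' : set V) :
  small D S -> small D S' -> small D (S `*` S').
Proof.
have main (U1 V1 : Type) (A : set U1) (B : set V1) :
    small D A -> B #<= A -> small D (A `*` B).
  move=> sA BA; have [Afin|Ainf] := pselect (finite_set A).
    by apply: small_finite; apply: finite_setX => //; exact: card_le_finite Afin.
  apply: small_le sA; apply: card_le_trans (card_setX_self_le Ainf).
  exact: card_le_setX.
move=> sS sS'; have [SS'|S'S] := card_le_total S S'; last exact: main.
apply: small_le (main _ _ _ _ sS' SS').
apply: (inj_le_card (f := fun p => (p.2, p.1))).
  by move=> [x y] [x' y'] _ _ [-> ->].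
by move=> _ [[x y] [Sx Sy] <-].
Qed.

Lemma small_image2 (U V W : Type) (S : set U) (S' : set V) (f : U -> V -> W) :
  small D S -> small D S' -> small D [set f x y | x in S & y in S'].
Proof.
move=> sS sS'; apply: small_le (small_setX sS sS').
rewrite image2E; exact: card_image_le.
Qed.

Lemma small_setU (U : Type) (S S' : set U) :
  small D S -> small D S' -> small D (S `|` S').
Proof.
move=> sS sS'; have [->|/set0P[x0 Sx0]] := eqVneq S set0; first by rewrite set0U.
have [->|/set0P[y0 Sy0]] := eqVneq S' set0; first by rewrite setU0.
have sB : small D [set: bool] by apply: small_finite; exact: finite_finset.
have := small_image2 (f := fun (b : bool) (p : U * U) => if b then p.1 else p.2)
  sB (small_setX sS sS').
apply: small_le.
apply: subset_card_le => z [Sz|Sz].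
  by exists true => //; exists (z, y0).
by exists false => //; exists (x0, z).
Qed.

(** The two cases of the proof are needed because D may be countable: then
    J is finite, and the bound |J| aleph_0 would be too large. *)
Lemma small_bigcup_seq (I : Type) (U : eqType) (J : set I) (s : I -> seq U) :
  small D J -> small D (\bigcup_(i in J) [set` s i]).
Proof.
move=> sJ; have [Jfin|Jinf] := pselect (finite_set J).
  by apply: small_finite; apply: bigcup_finite => // i _; exact: finite_seq.
have [->|/set0P[u0 _]] := eqVneq (\bigcup_(i in J) [set` s i]) set0.
  by apply: small_finite.
have sN : small D [set: nat] by apply: small_le sJ; exact/infiniteP.
have := small_image2 (f := fun i n => nth u0 (s i) n) sJ sN; apply: small_le.
apply: subset_card_le => x [i Ji /= xs]; exists i => //; exists (index x (s i)) => //.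
by rewrite nth_index.
Qed.

End small.

(** * Well-orders and alephs *)

(** An iterated pairing is injective on the sequences of each length; the
    length is recorded separately. *)
Lemma card_seq_le (T : Type) : infinite_set [set: T] ->
  [set: seq T] #<= [set: T].
Proof.
move=> Tinf; have [t0 _] := infinite_setN0 Tinf.
have [f fI] := card_leTP t0 (card_square_le Tinf).
have [e eI] := card_leTP t0 (proj1 (infiniteP _) Tinf).
pose code := foldr (fun x c => f (x, c)) t0.
have codeI s s' : size s = size s' -> code s = code s' -> s = s'.
  elim: s s' => [|x s IH] [|x' s'] //= [ss'] /fI[-> /IH-> //].
apply: (@card_le_inj _ _ (fun s => f (e (size s), code s))) => s s'.
by move=> /fI[/eI]; exact: codeI.
Qed.

(** In a well-order take the least i0 whose initial segment is as large as
    I, if there is one, and pull the order back along an injection of I into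
    that segment. *)
Lemma small_well_order (I : eqType) : exists lt : I -> I -> Prop,
  [/\ well_founded lt, forall i j, i <> j -> lt i j \/ lt j i &
      forall i, small [set: I] [set j | lt j i]].
Proof.
have [R wR] := wochoice.well_ordering_principle I.
pose lt i j := ~~ R j i.
have lt_tot i j : i <> j -> lt i j \/ lt j i.
  move=> ij; apply: contrapT => /not_orP[/negP/negPn Rji /negP/negPn Rij].
  apply: ij.
  have Ranti := wochoice.wo_chain_antisymmetric
    (wochoice.withinW (A := predT) wR).
  by apply: Ranti => //; rewrite Rij Rji.
have lt_min (Q : I -> Prop) i : Q i -> exists2 j, Q j & forall k, lt k j -> ~ Q k.
  move=> Qi; have [|j [[Qj Rj] _]] := wR [pred k | `[< Q k >]].
    by exists i; apply/asboolP.
  exists j; first by move/asboolP: Qj.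
  by move=> k /negP kj Qk; apply: kj; apply: Rj; apply/asboolP.
have lt_wf : well_founded lt.
  move=> i; apply: contrapT => /(lt_min (fun i => ~ Acc lt i))[j nj kj].
  apply: nj; constructor=> k /kj.
  exact: contrapT.
have [[i Ii]|nI] := pselect (exists i, [set: I] #<= [set j | lt j i]); last first.
  by exists lt; split=> // i Ii; apply: nI; exists i.
have [i0 Ii0 i0min] := lt_min (fun i => [set: I] #<= [set j | lt j i]) i Ii.
have [f [fI fi0]] := card_le_funP i0 Ii0.
have {}fI : injective f by move=> x y; apply: fI; rewrite in_setT.
exists (fun i j => lt (f i) (f j)); split.
- suff H k : forall j, f j = k -> Acc (fun i j => lt (f i) (f j)) j by move=> j; exact: H.
  have := lt_wf k; elim=> {}k _ IH j fj; constructor=> j' ltj'.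
  by apply: IH erefl; rewrite -fj.
- by move=> j k jk; apply: lt_tot => /fI.
- move=> j Ij; apply: (i0min (f j)); first by apply: fi0; exists j.
  apply: card_le_trans Ij _; apply: (inj_le_card (f := f)) => [x y _ _ /fI//|].
  by move=> _ [x xj <-].
Qed.

Lemma card_bigcup_le (I U X : Type) (P : I -> set U) (x0 : X) :
  (forall i, P i #<= [set: X]) ->
  \bigcup_i P i #<= [set: I] `*` [set: X].
Proof.
move=> PX; have /choice[f fP] := fun i => card_le_funP x0 (PX i).
have [->|/set0P[u0 [i0 _ _]]] := eqVneq (\bigcup_i P i) set0; first exact: card_ge0.
have /choice[k kP] : forall x, exists i, (\bigcup_i P i) x -> P i x.
  move=> x; have [[i _ Pix]|nP] := pselect ((\bigcup_i P i) x); first by exists i.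
  by exists i0.
apply: (inj_le_card (f := fun x => (k x, f (k x) x))) => // x y /set_mem Px /set_mem Py.
move=> [kxy]; rewrite -kxy; have [fI _] := fP (k x); apply: fI.
  by apply/mem_set; exact: kP.
by rewrite kxy; apply/mem_set; exact: kP.
Qed.

Lemma infinite_aleph n : infinite_set [set: aleph n].
Proof.
apply/infiniteP; elim: n => [|n IH] /=; first exact: card_lexx.
by have [[+ _] _] := succ_cardP (aleph n); exact: card_le_trans.
Qed.

(** Only the regularity of successor cardinals is behind this. In the
    inductive step, if S is not bounded by aleph n and if no P k is as large
    as S, then each P k has at most aleph n elements, and so has their union.
    Since aleph_0 is not of uncountable cofinality, the base case relies on
    each P k being infinite. *)
Lemma card_le_bigcup_aleph n (T U : Type) (S : set T) (P : nat -> set U) :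
  S #<= [set: aleph n] -> (forall k, infinite_set (P k)) ->
  S #<= \bigcup_k P k -> exists k, S #<= P k.
Proof.
move=> + Pinf SP; elim: n => [|n IH] Sn.
  by exists 0%N; apply: card_le_trans Sn _; exact/infiniteP.
have [/IH//|nSn] := pselect (S #<= [set: aleph n]).
apply: contrapT => /forallNP nSP; apply: nSn.
have Pn k : P k #<= [set: aleph n].
  have [//|nP] := card_le_total (P k) [set: aleph n].
  apply: contrapT => Pn; apply: (nSP k).
  have PT : [set: P k] #= P k by exact: card_setT.
  have [_ /(_ (set_type (P k)))] := succ_cardP (aleph n).
  rewrite /card_lt (card_le_eqr PT) (card_le_eql PT) => /(_ (conj nP Pn)).
  by rewrite (card_le_eqr PT); exact: card_le_trans.
have [x0 _] := infinite_setN0 (@infinite_aleph n).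
apply: card_le_trans SP _; apply: card_le_trans (card_bigcup_le x0 Pn) _.
apply: card_le_trans (card_setX_self_le (@infinite_aleph n)).
apply: card_le_setX; last exact: card_lexx.
by apply/infiniteP; exact: infinite_aleph.
Qed.

(** * Right-invariant pseudometrics *)

Section right_invariant.
Variables (R : realType) (G : topologicalGroupType).
Implicit Types (D : G -> G -> R) (x y z : G).

(** Right translations reduce continuity at (x, y) to small values of D near
    the identity, by the triangle inequality. *)
Lemma RP_of_nbhs1 D : is_pseudometric D ->
  (forall x y z, D (x * z)%g (y * z)%g = D x y) ->
  (forall e, 0 < e -> \forall x \near (1%g : G), D x 1%g < e) -> RP R G D.
Proof.
move=> [D0 Dge0 Dsym Dtri] Dr Dnear; split=> // -[x y].
apply/cvgrPdist_lt => e e0.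
have near_lt z : \forall z' \near z, D z' z < e / 2.
  have cz : (z' * z^-1)%g @[z' --> z] --> (z * z^-1)%g.
    have := @cvg_comp2 _ _ _ _ _ _ _ _ _ _ _ id (fun=> z^-1%g) (fun a b => (a * b)%g)
      (@cvg_id _ (nbhs z)) (cvg_cst z^-1%g) (@mulg_continuous G (z, z^-1%g)).
    exact.
  have e20 : 0 < e / 2 by rewrite divr_gt0.
  rewrite mulgV in cz.
  have nz : \forall z' \near z, D (z' * z^-1)%g 1%g < e / 2.
    exact: (cz _ (Dnear _ e20)).
  apply: filterS nz => z'.
  by rewrite -(mulgV z) Dr.
exists ([set x' | D x' x < e / 2], [set y' | D y' y < e / 2]).
  by split=> /=; [exact: (near_lt x)|exact: (near_lt y)].
move=> [x' y'] /= [xx' yy']; rewrite ltr_norml.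
have := Dtri x x' y; have := Dtri x' y' y.
have := Dtri x' x y'; have := Dtri x y y'.
rewrite (Dsym x x') (Dsym y y'); lra.
Qed.

Lemma RP_addr D D' :
  RP R G D -> RP R G D' -> RP R G (fun x y => D x y + D' x y).
Proof.
move=> [[D0 Dge0 Dsym Dtri] Dc Dr] [[D'0 D'ge0 D'sym D'tri] D'c D'r]; split.
- split=> [x|x y|x y|x y z].
  + by rewrite D0 D'0 addr0.
  + by rewrite addr_ge0.
  + by rewrite Dsym D'sym.
  + by rewrite addrACA lerD.
- by move=> xy; apply: cvgD; [exact: Dc|exact: D'c].
- by move=> x y z; rewrite Dr D'r.
Qed.

Lemma RP_mulr (c : R) D : 0 <= c -> RP R G D -> RP R G (fun x y => c * D x y).
Proof.
move=> c0 [[D0 Dge0 Dsym Dtri] Dc Dr]; split.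
- split=> [x|x y|x y|x y z].
  + by rewrite D0 mulr0.
  + by rewrite mulr_ge0.
  + by rewrite Dsym.
  + by rewrite -mulrDr ler_wpM2l.
- by move=> xy; apply: cvgM; [exact: cvg_cst|exact: Dc].
- by move=> x y z; rewrite Dr.
Qed.

Lemma RP_upper_bound (A : set (G -> G -> R)) : finite_set A -> A `<=` RP R G ->
  exists2 D, RP R G D & forall D', A D' -> forall x y, D' x y <= D x y.
Proof.
move=> /finite_seqP[s ->]; elim: s => [|D1 s IH] sRP.
  exists (fun _ _ => 0) => //; split=> //.
    by split=> // x y z; rewrite addr0.
  by move=> xy; exact: cvg_cst.
have [D' D's|D DRP Dub] := IH; first by apply: sRP; rewrite /= inE D's orbT.
have D1RP : RP R G D1 by apply: sRP; rewrite /= mem_head.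
exists (fun x y => D1 x y + D x y); first exact: RP_addr.
have [[_ D1ge0 _ _] _ _] := D1RP; have [[_ Dge0 _ _] _ _] := DRP.
move=> D' /=; rewrite inE => /orP[/eqP->|D's] x y; first by rewrite lerDl.
by apply: le_trans (Dub D' D's x y) _; rewrite lerDr.
Qed.

End right_invariant.

(** * The Birkhoff-Kakutani theorem *)

Section birkhoff_kakutani.
Variable G : topologicalGroupType.

Lemma nbhs1_cube (U : set G) : nbhs (1%g : G) U -> exists V : set G,
  nbhs (1%g : G) V /\ forall x y z, V x -> V y -> V z -> U (x * y * z)%g.
Proof.
have sq (W : set G) : nbhs (1%g : G) W -> exists V : set G,
    nbhs (1%g : G) V /\ forall x y, V x -> V y -> W (x * y)%g.
  move=> nW; have c : (p.1 * p.2)%g @[p --> (1%g : G, 1%g : G)] --> (1 * 1 : G)%g.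
    exact: (@mulg_continuous G (1%g, 1%g)).
  rewrite mulg1 in c; have [[V V'] [/= nV nV'] VW] := c _ nW.
  exists (V `&` V'); split; first exact: filterI.
  by move=> x y [Vx _] [_ Vy]; apply: (VW (x, y)).
move=> /sq[V [nV VU]]; have [W [nW WV]] := sq _ nV.
exists (W `&` V); split; first exact: filterI.
by move=> x y z [Wx _] [Wy _] [_ Vz]; apply: VU => //; exact: WV.
Qed.

(** Give W_n the weight 2^-n. The norm of x is the infimum of the total weights
    of the products W_{n_1} ... W_{n_k} that contain x. *)
Section chains.
Variables (R : realType) (W : nat -> set G).
Hypothesis W0 : W 0 = setT.
Hypothesis W1 : forall n, W n 1%g.
Hypothesis W_cube : forall n x y z,
  W n.+1 x -> W n.+1 y -> W n.+1 z -> W n (x * y * z)%g.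

Fixpoint chain_products (s : seq nat) : set G :=
  if s is n :: s' then [set (x * y)%g | x in W n & y in chain_products s']
  else [set 1%g].

Let weight (s : seq nat) : R := \sum_(n <- s) 2^-1 ^+ n.

Let weight_ge0 s : 0 <= weight s.
Proof. by apply: sumr_ge0 => n _; rewrite exprn_ge0 // invr_ge0. Qed.

Let weight_cons n s : weight (n :: s) = 2^-1 ^+ n + weight s.
Proof. by rewrite /weight big_cons. Qed.

Lemma chain_products_cat s t x :
  chain_products (s ++ t) x <->
  exists y z, [/\ chain_products s y, chain_products t z & x = (y * z)%g].
Proof.
elim: s x => [|n s IH] x /=.
  split=> [tx|[y [z [-> tz ->]]]]; last by rewrite mul1g.
  by exists 1%g, x; split=> //; rewrite mul1g.
split.
  move=> [a Wa [b /IH[y [z [sy tz ->]]] <-]].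
  by exists (a * y)%g, z; split=> //; [exists a => //; exists y|rewrite mulgA].
move=> [_ [z [[a Wa [y sy <-]] tz ->]]]; exists a => //.
by exists (y * z)%g; [apply/IH; exists y, z|rewrite mulgA].
Qed.

(** Cut at the first entry after which less than c' remains. What precedes
    that entry weighs less than c, because the part that starts with it weighs
    at least c' unless nothing precedes it. *)
Let weight_split s (c c' : R) : s != [::] -> 0 < c -> 0 < c' ->
  weight s < c + c' -> exists s1 a s2,
  [/\ s = s1 ++ a :: s2, weight s1 < c & weight s2 < c'].
Proof.
elim: s c => [//|a s IH] c _ c0 c'0; rewrite weight_cons => acc'.
have [sc'|c's] := ltP (weight s) c'.
  by exists [::], a, s; split=> //; rewrite /weight big_nil.
have [||//||s1 [b [s2 [-> s1c s2c']]]] := IH (c - 2^-1 ^+ a).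
- by apply: contra_leN c's => /eqP->; rewrite /weight big_nil.
- by rewrite subr_gt0; lra.
- by lra.
exists (a :: s1), b, s2; split=> //; rewrite weight_cons; lra.
Qed.

Let W_decr m n : (m <= n)%N -> W n `<=` W m.
Proof.
move=> /subnK <-; elim: (n - m)%N => [//|k IH] x Wx; apply: IH.
by have := W_cube Wx (W1 _) (W1 _); rewrite !mulg1.
Qed.

(** The sequence is cut as s1 ++ a :: s2, where s1 and s2 both weigh less than
    2^-(m+1). Their products lie in W_{m+1} by induction, W_a lies in W_{m+1}
    because 2^-a < 2^-m, and the cube condition applies. *)
Lemma chain_products_sub s m : weight s < 2^-1 ^+ m -> chain_products s `<=` W m.
Proof.
have [k] := ubnP (size s); elim: k => // k IH in s m *; rewrite ltnS => sk.
have [->|s0] := eqVneq s [::]; first by move=> _ x ->.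
have h0 n : 0 < 2^-1 ^+ n :> R by rewrite exprn_gt0 // invr_gt0.
have hS : 2^-1 ^+ m.+1 + 2^-1 ^+ m.+1 = 2^-1 ^+ m :> R.
  by rewrite exprS; lra.
rewrite -{1}hS => sm.
have [s1 [a [s2 [E s1m s2m]]]] := weight_split s0 (h0 _) (h0 _) sm.
have am : (m < a)%N.
  rewrite ltnNge; apply/negP => am; move: sm; rewrite hS E ltNge => /negP; apply.
  apply: (@le_trans _ _ (2^-1 ^+ a)); first by rewrite ler_wiXn2l //; lra.
  rewrite /weight big_cat big_cons /=.
  have := weight_ge0 s1; have := weight_ge0 s2; rewrite /weight; lra.
move=> x; rewrite E => /chain_products_cat[y [_ [s1y [b Wb [z s2z <-]] ->]]].
rewrite mulgA; move: sk; rewrite E size_cat /= addnS => sk.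
apply: W_cube; [apply: (IH s1) => //|exact: W_decr am _ Wb|apply: (IH s2) => //].
  by apply: leq_trans sk; rewrite ltnS leq_addr.
by apply: leq_trans sk; rewrite ltnS leq_addl.
Qed.

Definition chain_norm (x : G) : R :=
  inf [set weight s | s in [set s | chain_products s x]].

Let chain_norm_le s x : chain_products s x -> chain_norm x <= weight s.
Proof.
move=> sx; apply: ge_inf; last by exists s.
by exists 0 => _ [t _ <-].
Qed.

Let chain_norm_has_inf x :
  has_inf [set weight s | s in [set s | chain_products s x]].
Proof.
split; last by exists 0 => _ [t _ <-].
exists (weight [:: 0%N]), [:: 0%N] => //=; exists x; first by rewrite W0.
by exists 1%g => //; rewrite mulg1.
Qed.

Let chain_norm_adherent x (e : R) : 0 < e ->
  exists2 s, chain_products s x & weight s < chain_norm x + e.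
Proof.
by move=> e0; have [_ [s sx <-]] := inf_adherent e0 (chain_norm_has_inf x); exists s.
Qed.

Lemma chain_norm_ge0 x : 0 <= chain_norm x.
Proof.
by apply: lb_le_inf; [have [] := chain_norm_has_inf x|move=> _ [s _ <-]].
Qed.

Lemma chain_norm1 : chain_norm 1%g = 0.
Proof.
apply/eqP; rewrite eq_le chain_norm_ge0 andbT.
have := @chain_norm_le [::] 1%g; rewrite /weight big_nil; exact.
Qed.

Lemma chain_normM x y : chain_norm (x * y)%g <= chain_norm x + chain_norm y.
Proof.
apply/ler_addgt0Pr => e e0; have e20 : 0 < e / 2 by rewrite divr_gt0.
have [s sx sl] := chain_norm_adherent x e20.
have [t ty tl] := chain_norm_adherent y e20.
have /chain_norm_le : chain_products (s ++ t) (x * y)%g.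
  by apply/chain_products_cat; exists x, y.
rewrite /weight big_cat; move: sl tl; rewrite /weight /=; lra.
Qed.

Lemma chain_norm_W n x : W n x -> chain_norm x <= 2^-1 ^+ n.
Proof.
move=> Wx; have /chain_norm_le : chain_products [:: n] x.
  by exists x => //; exists 1%g => //; rewrite mulg1.
by rewrite weight_cons /weight big_nil addr0.
Qed.

Lemma W_chain_norm n x : chain_norm x < 2^-1 ^+ n -> W n x.
Proof.
rewrite -subr_gt0 => /(chain_norm_adherent x)[s sx sl].
by apply: (@chain_products_sub s) => //; move: sl; rewrite addrC subrK.
Qed.

End chains.

(** The chain norm is subadditive but not symmetric, since the W_n are not;
    this is why the pseudometric adds the norms of x y^-1 and y x^-1. *)
Lemma RP_unit_ball_sub (R : realType) (U : set G) : nbhs (1%g : G) U ->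
  exists2 D, RP R G D & forall x, D x 1%g < 1 -> U x.
Proof.
move=> nU; have /choice[c cP] : forall V : set G, exists V' : set G,
    nbhs (1%g : G) V -> nbhs (1%g : G) V' /\
    forall x y z, V' x -> V' y -> V' z -> V (x * y * z)%g.
  move=> V; have [/nbhs1_cube[V' V'P]|nV] := pselect (nbhs (1%g : G) V).
    by exists V'.
  by exists V.
(* The extra term W 0 = setT makes every chain norm finite, at the cost of
   having U at index 1, where the radius is 1/2. *)
pose W n := if n is m.+1 then iter m c U else setT.
have nW n : nbhs (1%g : G) (W n).
  case: n => [|n]; first exact: filterT.
  by elim: n => [//|n IH] /=; have [] := cP _ IH.
have W1 n : W n 1%g by exact: nbhs_singleton.
have W_cube n x y z : W n.+1 x -> W n.+1 y -> W n.+1 z -> W n (x * y * z)%g.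
  by case: n => [//|n]; have [_] := cP _ (nW n.+1); apply.
pose N := chain_norm R W.
have N_ge0 := @chain_norm_ge0 R W erefl.
have N_M := @chain_normM R W erefl.
have N_near (e : R) : 0 < e -> \forall x \near (1%g : G), N x < e.
  move=> e0; have [n ne] : exists n, (2^-1 : R) ^+ n < e.
    have [k _ kP] := near_infty_natSinv_expn_lt (interval_inference.PosNum e0).
    by exists k; have := kP k (leqnn k); rewrite /= div1r exprVn.
  apply: filterS (nW n) => x Wx; apply: le_lt_trans ne.
  exact: chain_norm_W.
exists (fun x y => 2 * (N (x * y^-1)%g + N (y * x^-1)%g)).
  apply: RP_mulr => //; apply: RP_of_nbhs1.
  - split=> [x|x y|x y|x y z].
    + by rewrite mulgV /N chain_norm1 // addr0.
    + by rewrite addr_ge0.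
    + by rewrite addrC.
    + have h a b d : N (a * d^-1)%g <= N (a * b^-1)%g + N (b * d^-1)%g.
        rewrite -[(a * d^-1)%g](_ : (a * b^-1) * (b * d^-1) = _)%g ?N_M //.
        by rewrite mulgA mulgVK.
      by have := h x y z; have := h z y x; lra.
  - by move=> x y z; rewrite !invgM !mulgA !mulgK.
  - move=> e e0; have e20 : 0 < e / 2 by rewrite divr_gt0.
    have nN := N_near _ e20.
    have nNV : \forall x \near (1%g : G), N (x^-1)%g < e / 2.
      have cV : (x^-1)%g @[x --> (1%g : G)] --> (1^-1 : G)%g.
        exact: (@invg_continuous G 1%g).
      by rewrite invg1 in cV; exact: (cV _ nN).
    apply: filterS2 nN nNV => x /=; rewrite invg1 mulg1 mul1g; lra.
move=> x; rewrite invg1 mulg1 mul1g => Dx.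
apply: (@W_chain_norm R W erefl W1 W_cube 1).
by have := N_ge0 (x^-1)%g; rewrite -/N expr1; lra.
Qed.

End birkhoff_kakutani.

(** * Coverings by translates and separated translates *)

(** This is Neumann's argument on coverings of a group by finitely many
    cosets. If some translate V_i x0 misses V_i P, then the rest of the
    covering contains V_i x0, hence V_i p = V_i x0 (x0^-1 p) is covered by
    right translates of the rest, and V_i can be dropped at the cost of
    enlarging P. Otherwise V_i x meets V_i P for every x, so that x lies in
    V_i^-1 V_i P. *)
Lemma small_translates_cover (T : Type) (D : set T) (Dinf : infinite_set D)
    (G : groupType) (I : eqType) (V : I -> set G) (s : seq I) (P : set G) :
  small D P ->
  (forall x, exists i p, [/\ i \in s, P p & V i (x * p^-1)%g]) ->
  exists i P', [/\ i \in s, small D P' &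
    forall x, exists u v p, [/\ V i u, V i v, P' p & x = (u^-1 * v * p)%g]].
Proof.
elim: s P => [|i s IH] P sP cover; first by have [? [? []]] := cover 1%g.
have [iP|/existsNP[x0 nx0]] :=
    pselect (forall x, exists u v p, [/\ V i u, V i v, P p & x = (u^-1 * v * p)%g]).
  by exists i, P; split=> //; exact: mem_head.
pose P' := P `|` [set (p' * (x0^-1 * p))%g | p' in P & p in P].
have [] := IH P'.
- by apply: small_setU => //; apply: small_image2.
- move=> y; have [j [p [+ Pp Vj]]] := cover y.
  rewrite inE => /orP[/eqP ji|js]; last by exists j, p; split=> //; left.
  have [k [p' [+ Pp' Vk]]] := cover (y * p^-1 * x0)%g.
  rewrite inE => /orP[/eqP ki|ks].
    exfalso; apply: nx0; exists (y * p^-1)%g, (y * p^-1 * x0 * p'^-1)%g, p'.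
    split=> //; [by rewrite -ji|by rewrite -ki|].
    by move: (y * p^-1)%g => a; rewrite !mulgA mulgVK mulVg mul1g.
  exists k, (p' * (x0^-1 * p))%g; split=> //; first by right; exists p' => //; exists p.
  by move: Vk; rewrite !invgM invgK !mulgA.
- by move=> j [Q [js sQ Qc]]; exists j, Q; split=> //; rewrite inE js orbT.
Qed.

Section separated.
Variables (R : realType) (G : topologicalGroupType) (Delta : G -> G -> R).
Hypothesis DeltaRP : RP R G Delta.
Variables (T : Type) (D : set T).
Hypothesis Dinf : infinite_set D.
Hypothesis D_le_dense : forall P : set G,
  (forall x, exists2 p, P p & Delta x p < 2) -> D #<= P.

(** Otherwise G is the union of the a^-1 B p, with a in s, p in P and B the
    open unit ball at 1. In (a^-1 B)^-1 (a^-1 B) = B^-1 B the element a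
    disappears, so that a small set would be 2-dense. *)
Lemma small_avoid (s : seq G) (P : set G) : small D P ->
  exists x, forall a p, a \in s -> P p -> 1 <= Delta (a * x)%g p.
Proof.
move=> sP; apply: contrapT => nx.
have [[D0 Dge0 Dsym Dtri] _ Dr] := DeltaRP.
have cover x : exists a p, [/\ a \in s, P p & Delta (a * x)%g p < 1].
  apply: contrapT => nap; apply: nx; exists x => a p sa Pp.
  by rewrite leNgt; apply/negP => ap; apply: nap; exists a, p.
pose V (a : G) := [set (a^-1 * z)%g | z in [set z | Delta z 1%g < 1]].
have [x|a [P' [sa sP' P'c]]] := small_translates_cover Dinf (V := V) (s := s) sP.
  have [a [p [sa Pp ap]]] := cover x; exists a, p; split=> //.
  exists (a * x * p^-1)%g; last by rewrite !mulgA mulVg mul1g.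
  by rewrite /= -(mulgV p) Dr.
apply: sP'; apply: D_le_dense => x.
have [_ [_ [p [[u /= u1 <-] [v /= v1 <-] P'p ->]]]] := P'c x.
exists p => //; rewrite -[p in X in _ X < _]mul1g Dr.
have -> : ((a^-1 * u)^-1 * (a^-1 * v) = u^-1 * v)%g.
  by rewrite invgM invgK !mulgA mulgK.
apply: le_lt_trans (Dtri _ v _) _.
have -> : Delta (u^-1 * v)%g v = Delta u 1%g.
  by rewrite -[v in X in Delta _ X]mul1g Dr -[LHS](Dr _ _ u) mulVg mul1g Dsym.
by rewrite (_ : 2 = 1 + 1)// ltrD.
Qed.

Lemma separated_translates (I : eqType) (F : I -> seq G) :
  [set: I] #<= D -> exists x : I -> G, forall i j, i <> j ->
  forall a b, a \in F i -> b \in F j -> 1 <= Delta (a * x i)%g (b * x j)%g.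
Proof.
move=> ID; have [lt [lt_wf lt_tot lt_small]] := small_well_order I.
have [[_ _ Dsym _] _ _] := DeltaRP.
have step (i : I) (y : I -> G) : exists x, forall j, lt j i ->
    forall a b, a \in F i -> b \in F j -> 1 <= Delta (a * x)%g (b * y j)%g.
  have sP : small D (\bigcup_(j in [set j | lt j i])
      [set` [seq (b * y j)%g | b <- F j]]).
    apply: small_bigcup_seq => // Dlt; apply: (lt_small i).
    exact: card_le_trans Dlt.
  have [x xP] := small_avoid (F i) sP; exists x => j ji a b Fa Fb.
  by apply: xP => //; exists j => //=; exact: map_f.
(* The values of the recursion at the predecessors of i are packed in a total
   function, with a dummy value elsewhere. *)
have /choice[g gP] : forall iy : I * (I -> G), exists x, forall j, lt j iy.1 ->
    forall a b, a \in F iy.1 -> b \in F j -> 1 <= Delta (a * x)%g (b * iy.2 j)%g.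
  by move=> [i y]; exact: step.
pose body i (rec : forall j, lt j i -> G) : G :=
  g (i, fun j => if pselect (lt j i) is left h then rec j h else 1%g).
pose x := Fix lt_wf (fun=> G) body.
pose below i j := if pselect (lt j i) is left h then x j else 1%g.
have xE i : x i = g (i, below i).
  rewrite /x Fix_eq // => k r1 r2 r12; congr (g (k, _)); apply/funext => j.
  by case: pselect.
have xP i j : lt j i -> forall a b, a \in F i -> b \in F j ->
    1 <= Delta (a * x i)%g (b * x j)%g.
  move=> ji a b Fa Fb; have := gP (i, below i) j ji a b Fa Fb.
  by rewrite -xE /= /below; case: pselect => // nji; case: (nji ji).
exists x => i j /lt_tot[ij|ji] a b Fa Fb; last exact: xP.
by rewrite Dsym; exact: xP.
Qed.

End separated.

(** * The ambit *)

(** The sets of functions close to g at finitely many points generate a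
    filter that converges pointwise to g. *)
Lemma closure_ptws (R : realType) (T : topologicalType) (A : set (T -> R))
    (g : T -> R) :
  (forall (s : seq T) (e : R), 0 < e ->
     exists2 h, A h & forall z, z \in s -> `|h z - g z| < e) ->
  closure (A : set {ptws T -> R}) g.
Proof.
move=> Ag B nB.
pose F := filter_from [set p : seq T * R | 0 < p.2]
  (fun p => [set h : T -> R | forall z, z \in p.1 -> `|h z - g z| < p.2]).
have FF : Filter F.
  apply: filter_from_filter; first by exists ([::], 1) => /=.
  move=> [s e] [s' e'] /= e0 e'0; exists (s ++ s', Num.min e e') => /=.
    by rewrite lt_min e0.
  move=> h /= hss'; split=> z zs; have := hss' z; rewrite mem_cat zs ?orbT lt_min.
    by move=> /(_ isT)/andP[].
  by move=> /(_ isT)/andP[].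
have Fg : {ptws, F --> g}.
  apply/(pointwise_cvgP g FF) => z; apply/cvgrPdist_lt => e e0.
  exists ([:: z], e) => //= h /= hz; rewrite distrC; apply: hz; exact: mem_head.
have [[s e] /= e0 sB] := Fg _ nB.
by have [h Ah hs] := Ag s e e0; exists h; split=> //; exact: sB.
Qed.

Section ambit.
Variables (R : realType) (G : topologicalGroupType) (Delta : G -> G -> R).
Hypothesis DeltaRP : RP R G Delta.

Lemma Ub_lipschitz (f : G -> R) : (forall y, 0 <= f y <= 1) ->
  (forall y z, f y <= f z + Delta y z) -> Ub R (rG R G) f.
Proof.
move=> f01 flip; have [[_ _ Dsym _] _ _] := DeltaRP; split.
  exists 1; split=> // M M1 y _ /=; have /andP[f0 f1] := f01 y.
  by rewrite ger0_norm // (le_trans f1) // ltW.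
move=> E; rewrite -entourage_ballE => -[e /= e0 eE].
exists [set Delta], e; split=> //; first by move=> _ ->.
move=> x y /(_ _ erefl) xy; apply: eE; rewrite /= /ball /= ltr_norml.
by have := flip x y; have := flip y x; rewrite (Dsym y x); lra.
Qed.

(** The size of the 2-dense sets gives the room for the translates x_s. The
    approximations s only involve points of the dense set D, which is enough
    because f and g are 1-Lipschitz. *)
Lemma ambit_dense (D : set G) : infinite_set D ->
  (forall x e, 0 < e -> exists2 d, D d & Delta x d < e) ->
  (forall P : set G, (forall x, exists2 p, P p & Delta x p < 2) -> D #<= P) ->
  exists2 f : G -> R, Ub R (rG R G) f &
    BLip_plus Delta `<=` closure (orb f : set {ptws G -> R}).
Proof.
move=> Dinf Ddense D_le; have [[D0 Dge0 Dsym Dtri] Dc Dr] := DeltaRP.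
pose I : eqType := seq (D * rat).
have ID : [set: I] #<= D.
  have DT : [set: D] #= D := card_setT D.
  have ratD : [set: rat] #<= D.
    by rewrite (card_le_eql card_rat); exact/infiniteP.
  have DR : [set: D] `*` [set: rat] #<= D.
    apply: card_le_trans (card_setX_self_le Dinf); apply: card_le_setX => //.
    by rewrite (card_le_eql DT).
  apply: card_le_trans DR; rewrite setXTT; apply: card_seq_le.
  apply: (infinite_card_le (A := D)) => //.
  rewrite -(card_le_eql DT).
  by apply: (@card_le_inj _ _ (fun d : D => (d, 0 : rat))) => d d' [].
have [x xP] := separated_translates DeltaRP Dinf D_le
  (fun s : I => [seq \val p.1 | p <- s]) ID.
pose A y := [set t : R | t = 0 \/ exists s p, [/\ p \in s, ratr p.2 <= 1 :> R &
  t = ratr p.2 - Delta y (\val p.1 * x s)%g]].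
pose f y := sup (A y).
have A0 y : A y !=set0 by exists 0; left.
have A1 y : ubound (A y) 1.
  move=> t [->//|[s [p [_ p1 ->]]]]; rewrite lerBlDr.
  by apply: le_trans p1 _; rewrite lerDl.
have f_ge y t : A y t -> t <= f y by move=> At; apply: ub_le_sup => //; exists 1.
have f_le y t : (forall u, A y u -> u <= t) -> f y <= t by move=> ut; exact: ge_sup.
have f01 y : 0 <= f y <= 1.
  by apply/andP; split; [apply: f_ge; left|apply: f_le; exact: A1].
have flip y z : f y <= f z + Delta y z.
  apply: f_le => _ [->|[s [p [ps p1 ->]]]].
    by rewrite addr_ge0 //; have /andP[] := f01 z.
  have : A z (ratr p.2 - Delta z (\val p.1 * x s)%g) by right; exists s, p.
  move=> /f_ge; have := Dtri z y (\val p.1 * x s)%g; rewrite (Dsym z y); lra.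
exists f; first exact: Ub_lipschitz.
move=> g [g01 glip]; apply: closure_ptws => s e e0.
(* The rational values approach g from below, so that no pair in t makes f
   exceed g at the points d x_t. *)
have [t [tg tD]] : exists t : I, (forall p, p \in t -> ratr p.2 <= g (\val p.1)) /\
    forall z, z \in s -> exists2 p, p \in t &
      Delta z (\val p.1) < e / 4 /\ g (\val p.1) - e / 4 < ratr p.2.
  have e40 : 0 < e / 4 by rewrite divr_gt0.
  elim: s => [|z s [t [tg tD]]]; first by exists [::].
  have [d Dd zd] := Ddense z _ e40.
  have [|q] := @rat_in_itvoo R (g d - e / 4) (g d); first by lra.
  rewrite in_itv /= => /andP[q1 q2].
  exists ((SigSub (mem_set Dd), q) :: t); split.
    by move=> p; rewrite inE => /orP[/eqP->|/tg//]; exact: ltW.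
  move=> z'; rewrite inE => /orP[/eqP->|/tD[p pt pz]].
    by exists (SigSub (mem_set Dd), q) => //; exact: mem_head.
  by exists p => //; rewrite inE pt orbT.
exists (rho (x t) f); first by exists (x t).
move=> z zs; have [p pt [zp pq]] := tD z zs; rewrite /rho.
set d := \val p.1 in zp pq *.
have gf : g d - e / 4 < f (d * x t)%g.
  apply: lt_le_trans pq _; apply: f_ge; right; exists t, p; split=> //.
    by apply: le_trans (tg _ pt) _; have /andP[] := g01 (\val p.1).
  by rewrite D0 subr0.
have fg : f (d * x t)%g <= g d.
  apply: f_le => _ [->|[s' [p' [p's' p'1 ->]]]]; first by have /andP[] := g01 d.
  have [s't|s't] := eqVneq s' t.
    rewrite s't in p's' *; rewrite Dr; have := tg _ p's'.
    by have := glip d (\val p'.1); rewrite ler_norml => /andP[]; lra.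
  have /eqP/nesym ts' := s't.
  have := xP t s' ts' d (\val p'.1) (map_f (fun p => \val p.1) pt)
    (map_f (fun p => \val p.1) p's').
  have /andP[] := g01 d; lra.
have := flip (z * x t)%g (d * x t)%g; have := flip (d * x t)%g (z * x t)%g.
rewrite (Dsym (d * x t)%g) Dr; have := glip z d; rewrite ler_norml ltr_norml.
by move=> /andP[]; lra.
Qed.

End ambit.

(** * Dense sets and nets of least cardinality *)

Section density.
Variables (R : realType) (G : topologicalGroupType) (Delta : G -> G -> R).
Hypothesis DeltaRP : RP R G Delta.
Implicit Types (S P D U : set G) (c : R).

Definition net c P := forall x, exists2 p, P p & Delta x p < c.

Definition dense_for S := forall c, 0 < c -> net c S.

Lemma least_dense_set :
  exists2 D, dense_for D & forall S, dense_for S -> D #<= S.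
Proof.
have denseT : dense_for setT.
  have [[D0 _ _ _] _ _] := DeltaRP.
  by move=> c c0 x; exists x; rewrite ?D0.
have [[D dD] Dmin] :=
  card_least (fun S : {S | dense_for S} => sval S) (exist _ _ denseT).
by exists D => // S dS; exact: (Dmin (exist _ S dS)).
Qed.

Lemma least_net c : 0 < c -> exists2 P, net c P & forall Q, net c Q -> P #<= Q.
Proof.
move=> c0; have netT : net c setT.
  have [[D0 _ _ _] _ _] := DeltaRP.
  by move=> x; exists x; rewrite ?D0.
have [[P nP] Pmin] := card_least (fun P : {P | net c P} => sval P) (exist _ _ netT).
by exists P => // Q nQ; exact: (Pmin (exist _ Q nQ)).
Qed.

Variable D : set G.
Hypothesis D_least : forall S, dense_for S -> D #<= S.
Hypothesis Dinf : infinite_set D.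

(** Right invariance moves x p^-1 into the unit ball, hence into U, where H
    is dense; therefore H P is dense in G. *)
Lemma locally_small_net U H P : small D H ->
  (forall x, Delta x 1%g < 1 -> U x) ->
  (forall x, U x -> forall e, 0 < e -> exists2 h, H h & Delta x h < e) ->
  net 1 P -> D #<= P.
Proof.
move=> sH BU HU nP; apply: contrapT => sP.
have [_ _ Dr] := DeltaRP.
have := small_image2 (f := fun h p => (h * p)%g) Dinf sH sP; apply.
apply: D_least => e e0 x; have [p Pp xp] := nP x.
have [h Hh xph] : exists2 h, H h & Delta (x * p^-1)%g h < e.
  by apply: HU => //; apply: BU; rewrite -(mulgV p) Dr.
exists (h * p)%g; first by exists h => //; exists p.
by rewrite -(Dr _ _ p) mulgVK in xph.
Qed.

(** The union of least 1/(k+1)-nets is dense, and an aleph of finite index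
    cannot be reached by countably many smaller infinite cardinals. *)
Lemma aleph_net n : D #<= [set: aleph n] ->
  (forall P, net 1 P -> infinite_set P) ->
  exists c, [/\ 0 < c, c <= 1 & forall P, net c P -> D #<= P].
Proof.
move=> Dn net_inf.
have k_gt0 k : 0 < k.+1%:R^-1 :> R by rewrite invr_gt0 ltr0n.
have k_le1 k : k.+1%:R^-1 <= 1 :> R by rewrite invf_le1 ?ler1n ?ltr0n.
have /choice[P PP] : forall k, exists P,
    net k.+1%:R^-1 P /\ forall Q, net k.+1%:R^-1 Q -> P #<= Q.
  by move=> k; have [P nP Pmin] := least_net (k_gt0 k); exists P.
have Pinf k : infinite_set (P k).
  apply: net_inf => x; have [nP _] := PP k; have [p Pp xp] := nP x.
  by exists p => //; exact: lt_le_trans xp (k_le1 k).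
have [k DPk] : exists k, D #<= P k.
  apply: (card_le_bigcup_aleph Dn Pinf); apply: D_least => e e0 x.
  have [k _ ke] := near_infty_natSinv_lt (interval_inference.PosNum e0).
  have [nP _] := PP k; have [p Pp xp] := nP x; exists p; first by exists k.
  by apply: lt_trans xp _; exact: (ke k (leqnn k)).
exists k.+1%:R^-1; split=> // Q nQ; apply: card_le_trans DPk _.
by have [_] := PP k; apply.
Qed.

End density.

Lemma not_precompact_net (R : realType) (G : topologicalGroupType) :
  ~ precompact_group R G -> exists2 Delta, RP R G Delta &
    forall P, net Delta 1 P -> infinite_set P.
Proof.
move=> /existsNP[E /not_implyP[[A [e [Afin ARP e0 AE]]] nE]].
have [D DRP Dub] := RP_upper_bound Afin ARP.
have [[_ _ Dsym _] _ _] := DRP.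
exists (fun x y => e^-1 * D x y); first by apply: RP_mulr => //; rewrite invr_ge0 ltW.
move=> P nP Pfin; apply: nE; exists P => // x; have [p Pp xp] := nP x.
exists p => //; apply: AE => D' /Dub/(_ p x) D'D; apply: le_lt_trans D'D _.
by rewrite Dsym -[ltRHS]mulr1 -ltr_pdivrMl.
Qed.

(** * Ambitability *)

Theorem theorem4p6 (R : realType) (G : topologicalGroupType) (n : nat)
    (hG : hausdorff_space G) (hn : (0 < n)%N)
    (hb : locally_bounded R (aleph n) G) :
  precompact_group R G \/ ambitable R G.
Proof.
have [?|/not_precompact_net[D0 D0RP D0net]] := pselect (precompact_group R G).
  by left.
right=> D DRP; have [U nU Ub_] := hb.
have [DU DURP DUball] := RP_unit_ball_sub R nU.
pose D1 := fun x y => D x y + (DU x y + D0 x y).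
have D1RP : RP R G D1 by apply: RP_addr => //; exact: RP_addr.
have [[_ Dge0 _ _] _ _] := DRP; have [[_ DUge0 _ _] _ _] := DURP.
have [[_ D0ge0 _ _] _ _] := D0RP; have [[_ D1ge0 _ _] _ _] := D1RP.
have D_le x y : D x y <= D1 x y by rewrite lerDl addr_ge0.
have DU_le x y : DU x y <= D1 x y.
  by rewrite /D1; have := Dge0 x y; have := D0ge0 x y; lra.
have D0_le x y : D0 x y <= D1 x y.
  by rewrite /D1; have := Dge0 x y; have := DUge0 x y; lra.
have D1net P : net D1 1 P -> infinite_set P.
  move=> nP; apply: D0net => x; have [p Pp xp] := nP x; exists p => //.
  exact: le_lt_trans xp.
have [S Sdense Smin] := least_dense_set D1RP.
have Sinf : infinite_set S by apply: D1net; exact: Sdense.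
have [c [c0 c1 cS]] : exists c, [/\ 0 < c, c <= 1 & forall P, net D1 c P -> S #<= P].
  have [Sn|nS] := pselect (S #<= [set: aleph n]); first exact: aleph_net Sn D1net.
  have [H [HU Hdense Hn]] := Ub_ D1 D1RP.
  exists 1; split=> // P; apply: (locally_small_net D1RP Smin Sinf (H := H) (U := U)) => //.
    by move=> SH; apply: nS; exact: card_le_trans Hn.
  by move=> x x1; apply: DUball; exact: le_lt_trans x1.
have c20 : 0 < 2 / c by rewrite divr_gt0.
have D2RP := RP_mulr (ltW c20) D1RP.
have [x e e0|P nP|f fU fD] := ambit_dense D2RP Sinf.
- have [s Ss xs] := Sdense _ (divr_gt0 e0 c20) x.
  by exists s => //; rewrite mulrC -ltr_pdivlMr.
- apply: cS => x; have [p Pp xp] := nP x; exists p => //.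
  by move: xp; rewrite -ltr_pdivlMl // invf_div divfK // pnatr_eq0.
exists f => // g [g01 glip]; apply: fD; split=> // x y.
apply: le_trans (glip x y) _; apply: le_trans (D_le x y) _.
by rewrite ler_peMl // ler_pdivlMr //; lra.
Qed.
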